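(* Let $a,b,q\in\mathbb{C}$ with $|q|<1$, and put $$R:=\frac{(-a,b;q)_\infty-(a,-b;q)_\infty}{(-a,b;q)_\infty+(a,-b;q)_\infty}.$$ (i) If $|a^2|<1$ and $|ab/q|<1$, then $$R=\cfrac{(a-b)q}{(ab+q)(1-q)-\cfrac{(a-bq^2)(b-aq^2)q}{(ab+q)(1-q^3)-\cfrac{(a-bq^4)(b-aq^4)q}{(ab+q)(1-q^5)-\cfrac{(a-bq^6)(b-aq^6)q}{(ab+q)(1-q^7)-\cdots}}}},$$ i.e. $R=\cfrac{(a-b)q}{d_0-\cfrac{c_1}{d_1-\cfrac{c_2}{d_2-\cdots}}}$ with $d_n=(ab+q)(1-q^{2n+1})$ for $n\ge0$ and $c_n=(a-bq^{2n})(b-aq^{2n})q$ for $n\ge1$. (ii) If $|a^2|<1$ and $|aq/b|<1$, then $$R=\cfrac{a-b}{1-ab-\cfrac{(1-a^2)(1-b^2)q}{1-abq^2-\cfrac{(a-bq^2)(b-aq^2)q}{1-abq^4-\cfrac{(1-a^2q^2)(1-b^2q^2)q^3}{1-abq^6-\cfrac{(a-bq^4)(b-aq^4)q^3}{1-abq^8-\cdots}}}}},$$ i.e. $R=\cfrac{a-b}{d_0-\cfrac{c_1}{d_1-\cfrac{c_2}{d_2-\cdots}}}$ with $d_k=1-abq^{2k}$ for $k\ge0$, and $c_{2n-1}=(1-a^2q^{2n-2})(1-b^2q^{2n-2})q^{2n-1}$, $c_{2n}=(a-bq^{2n})(b-aq^{2n})q^{2n-1}$ for $n\ge1$.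
   Context: $(x;q)_\infty=\prod_{n\ge0}(1-xq^n)$ and $(x,y;q)_\infty=(x;q)_\infty(y;q)_\infty$. An infinite continued fraction with nonzero partial numerators has value $f\in\mathbb{C}\cup\{\infty\}$ if its finite truncations (approximants) converge to $f$. The parameters are assumed to be such that both sides make sense: $q\neq0$, $b\ne0$ in (ii), the denominator of $R$ is nonzero, and all partial numerators of the continued fraction are nonzero. *)

(* Defs.v *)
From mathcomp Require Import all_boot all_order all_algebra.
From mathcomp Require Import all_classical all_reals all_analysis.
From mathcomp Require Import complex.

Set Implicit Arguments.
Unset Strict Implicit.
Unset Printing Implicit Defensive.

Import Order.TTheory GRing.Theory Num.Theory.
Import numFieldNormedType.Exports.

Local Open Scope classical_set_scope.
Local Open Scope ring_scope.
Local Open Scope complex_scope.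

(* (x; q)_oo; the regular module R[i]^o carries the usual topology of the complex
   plane, which is not inferred from R[i] itself. *)
Definition qpoch {R : realType} (x q : R[i]) : R[i] :=
  limn (fun n => \prod_(k < n) (1 - x * q ^+ k) : R[i]^o).

(* (x, y; q)_oo *)
Definition qpoch2 {R : realType} (x y q : R[i]) : R[i] := qpoch x q * qpoch y q.

(* The extended complex plane; None is the point at infinity. *)
Notation sphere R := (one_point_compactification R[i]^o).

(* c / z on the extended plane, for a nonzero complex number c. *)
Definition sdiv {R : realType} (c : R[i]) (z : sphere R) : sphere R :=
  if z is Some w then if w == 0 then None else Some (c / w) else Some 0.

(* d - z on the extended plane. *)
Definition ssub {R : realType} (d : R[i]) (z : sphere R) : sphere R :=
  if z is Some w then Some (d - w) else None.

(* cf_tail c d m n is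
     c_m / (d_m - c_(m+1) / (d_(m+1) - ... - c_(m+n) / d_(m+n))). *)
Fixpoint cf_tail {R : realType} (c d : nat -> R[i]) (m n : nat) : sphere R :=
  if n is n'.+1 then sdiv (c m) (ssub (d m) (cf_tail c d m.+1 n'))
  else sdiv (c m) (Some (d m)).

(* The continued fraction c_0 / (d_0 - c_1 / (d_1 - c_2 / (d_2 - ...))), all of
   whose partial numerators c_n are assumed nonzero, has value f. *)
Definition cf_has_value {R : realType} (c d : nat -> R[i]) (f : sphere R) :=
  cf_tail c d 0 n @[n --> \oo] --> f.

Definition c_i {R : realType} (a b q : R[i]) (n : nat) : R[i] :=
  if n == 0%N then (a - b) * q
  else (a - b * q ^+ (2 * n)%N) * (b - a * q ^+ (2 * n)%N) * q.

Definition d_i {R : realType} (a b q : R[i]) (n : nat) : R[i] :=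
  (a * b + q) * (1 - q ^+ (2 * n + 1)%N).

(* For k >= 1, either k = 2n - 1 is odd, or k = 2n is even. *)
Definition c_ii {R : realType} (a b q : R[i]) (k : nat) : R[i] :=
  if k == 0%N then a - b
  else if odd k then
    (1 - a ^+ 2 * q ^+ (k - 1)%N) * (1 - b ^+ 2 * q ^+ (k - 1)%N) * q ^+ k
  else (a - b * q ^+ k) * (b - a * q ^+ k) * q ^+ (k - 1)%N.

Definition d_ii {R : realType} (a b q : R[i]) (k : nat) : R[i] :=
  1 - a * b * q ^+ (2 * k)%N.

(* Main.v *)
(* Both continued fractions come from a three-term recurrence
   e_n g_n = d_n g_(n+1) - (c_(n+1) / e_(n+1)) g_(n+2) solved by Heine series.
   With Phi(i, m) = 2phi1(bq/a, b p^i/a; q p^i; p; a^2 p^m) and p = q^2, case (i) uses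
   g_n = Phi(n, 0) and case (ii) uses g_(2n) = Phi(n, n), g_(2n+1) = Phi(n+1, n), which
   converges to 1 already for |a^2| < 1.  Since g_n has a nonzero limit, the suitably
   scaled denominators of the approximants satisfy a first-order recurrence that is
   asymptotically a contraction, so they converge, and the approximants converge to
   c_0 g_1 / (e_0 g_0).  By the q-binomial theorem, Phi(0, 0) and
   (a - b) / (1 - q) Phi(1, 0) are the even and odd parts of
   (b; q)_oo / (a; q)_oo under (a, b) -> (-a, -b), whence the ratio of products. *)

Require Import Defs.
From mathcomp Require Import all_boot all_order all_algebra.
From mathcomp Require Import all_classical all_reals all_analysis.
From mathcomp Require Import complex ring lra.

Set Implicit Arguments.
Unset Strict Implicit.
Unset Printing Implicit Defensive.

Import Order.TTheory GRing.Theory Num.Theory.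
Import numFieldNormedType.Exports.
Import Normc.
Local Open Scope classical_set_scope.
Local Open Scope ring_scope.
Local Open Scope complex_scope.

(* Convergence in R[i]^o, sealed in an inductive type to keep unification from
   unfolding the topological structures of R[i]^o. *)
Variant cvgc {R : realType} (u : nat -> R[i]) (l : R[i]) : Prop :=
  Cvgc of u @ \oo --> (l : R[i]^o).

Local Notation "u ~> l" := (cvgc u l) (at level 70).

(** * Limits of sequences in the complex plane *)

Section ComplexSequences.
Variable R : realType.
Implicit Types (u v : nat -> R[i]) (x y l : R[i]).

Lemma normcE_norm x : `|x| = (normc x)%:C. Proof. by []. Qed.

Lemma normc_ge0 x : 0 <= normc x.
Proof. by rewrite -ler0c -normcE_norm. Qed.

Lemma ler_normcD x y : normc (x + y) <= normc x + normc y.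
Proof. exact: le_normcD. Qed.

Lemma normc_eq0 x : (normc x == 0) = (x == 0).
Proof. by rewrite -(normr_eq0 x) normcE_norm (inj_eq (@complexI R)). Qed.

Lemma normcX x n : normc (x ^+ n) = normc x ^+ n.
Proof. by elim: n => [|n IH]; rewrite ?expr0 ?normc1 // !exprS normcM IH. Qed.

Lemma normc_lt1 x : (`|x| < 1) = (normc x < 1).
Proof. by rewrite normcE_norm -[1]/(1%:C) ltcR. Qed.

Lemma cvgcE u l : (u ~> l) = (u @ \oo --> (l : R[i]^o)).
Proof. by apply/propext; split=> [[]|]. Qed.

(** A positive element of [R[i]] is real, so complex and real tolerances correspond and estimates
    can be made over [R]. *)
Lemma cvgcP u l : u ~> l <-> normc (l - u n) @[n --> \oo] --> (0 : R).
Proof.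
rewrite cvgcE.
have E := @cvgrPdist_lt R[i] R[i]^o nat \oo _ u l.
have E0 := @cvgrPdist_lt R R^o nat \oo _ (fun n => normc (l - u n)) 0.
split=> [/E h|/E0 h].
  apply/E0 => e e0; have e0' : 0 < e%:C by rewrite ltcR.
  apply: filterS (h _ e0') => n.
  by rewrite normcE_norm ltcR sub0r normrN ger0_norm ?normc_ge0.
apply/E => e e0.
have ee : e = (complex.Re e)%:C by rewrite RRe_real // realE (ltW e0).
have e0' : 0 < complex.Re e by rewrite -ltcR -ee.
apply: filterS (h _ e0') => n.
rewrite sub0r normrN ger0_norm ?normc_ge0 // => hn.
by rewrite normcE_norm [X in _ < X]ee ltcR.
Qed.

Lemma cvgc_cst l : (fun=> l) ~> l.
Proof. by split; exact: (@cvg_cst (R[i]^o)). Qed.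

Lemma cvgcD u v x y : u ~> x -> v ~> y -> (fun n => u n + v n) ~> (x + y).
Proof.
move=> [ux] [vy]; split; have h := @cvgD R[i] R[i]^o nat \oo _ u v x y.
exact: (h _ ux vy).
Qed.

Lemma cvgcN u x : u ~> x -> (fun n => - u n) ~> (- x).
Proof.
by move=> [ux]; split; have h := @cvgN R[i] R[i]^o nat \oo _ u x; exact: (h _ ux).
Qed.

Lemma cvgcB u v x y : u ~> x -> v ~> y -> (fun n => u n - v n) ~> (x - y).
Proof. by move=> ux vy; exact: cvgcD ux (cvgcN vy). Qed.

Lemma cvgcM u v x y : u ~> x -> v ~> y -> (fun n => u n * v n) ~> (x * y).
Proof. by move=> [ux] [vy]; split; apply: (@cvgM R[i] _ _ _ u v x y ux vy). Qed.

Lemma cvgcV u x : x != 0 -> u ~> x -> (fun n => (u n)^-1) ~> x^-1.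
Proof. by move=> x0 [ux]; split; apply: (@cvgV R[i] _ _ _ u x x0 ux). Qed.

Lemma cvgc_eq u v x : u ~> x -> u =1 v -> v ~> x.
Proof. by move=> + /funext <-. Qed.

Lemma cvgc_shiftn N u x : ((fun n => u (n + N)%N) ~> x) = (u ~> x).
Proof. by rewrite !cvgcE (@cvg_shiftn N R[i]^o u (nbhs (x : R[i]^o))). Qed.

Lemma cvgc_shiftS u x : ((fun n => u n.+1) ~> x) = (u ~> x).
Proof. by rewrite !cvgcE (@cvg_shiftS R[i]^o u (nbhs (x : R[i]^o))). Qed.

Lemma cvgc_even_odd u x : (fun n => u n.*2) ~> x -> (fun n => u n.*2.+1) ~> x ->
  u ~> x.
Proof.
move=> /cvgcP he /cvgcP ho; apply/cvgcP/cvgrPdist_lt => e e0.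
have [N _ hN] := (cvgrPdist_lt _ _).1 he _ e0.
have [M _ hM] := (cvgrPdist_lt _ _).1 ho _ e0.
exists (N + M).*2.+1 => // n /= hn; rewrite -[n]odd_double_half.
have hh : (N + M <= n./2)%N.
  by have := half_leq hn; rewrite -[(_.*2.+1)%N]/(true + _)%N half_bit_double.
case: (odd n); rewrite ?add1n ?add0n.
  by apply: hM; rewrite /= (leq_trans _ hh) // leq_addl.
by apply: hN; rewrite /= (leq_trans _ hh) // leq_addr.
Qed.

(** The plane embeds continuously in the sphere. Agreement for large [n] suffices, so early
    approximants may be infinite. *)
Lemma cvgc_sphere u x (z : nat -> sphere R) : u ~> x ->
  (\forall n \near \oo, z n = Some (u n)) -> z @ \oo --> (Some x : sphere R).
Proof.
move=> [ux] zu.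
have h := cvg_comp _ _ ux (@one_point_compactification_some_continuous R[i]^o x).
by apply: cvg_trans h; apply: near_eq_cvg; apply: filterS zu => n ->.
Qed.

Lemma cvgc_unique {u x y} : u ~> x -> u ~> y -> x = y.
Proof. by move=> [ux] [uy]; exact: (cvg_unique (@norm_hausdorff _ R[i]^o) ux uy). Qed.

Lemma cvgc_lim u x : u ~> x -> limn (u : nat -> R[i]^o) = x.
Proof. by move=> [ux]; exact: (cvg_lim (@norm_hausdorff _ R[i]^o) ux). Qed.

Lemma cvgc_X x : normc x < 1 -> (fun n => x ^+ n) ~> 0.
Proof.
move=> x1; apply/cvgcP.
under eq_fun do rewrite sub0r normcN normcX.
by apply: cvg_expr; rewrite ger0_norm ?normc_ge0.
Qed.

Lemma cvgc_near_neq0 u x : u ~> x -> x != 0 -> \forall n \near \oo, u n != 0.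
Proof.
move=> /cvgcP/cvgrPdist_lt h x0; have := h _ (_ : 0 < normc x).
rewrite lt_def normc_eq0 x0 normc_ge0 => /(_ isT); apply: filterS => n.
rewrite sub0r normrN ger0_norm ?normc_ge0 //.
by apply: contraL => /eqP ->; rewrite subr0 ltxx.
Qed.

End ComplexSequences.

(** * Dominated series: ratio test, absolute convergence, Tannery's theorem *)

Section DominatedSeries.
Variable R : realType.
Implicit Types (u v : nat -> R[i]) (D r : nat -> R) (x l : R[i]).

Lemma ler_normc_Re x : `|complex.Re x| <= normc x.
Proof.
case: x => a b /=; rewrite -sqrtr_sqr ler_wsqrtr // lerDl; exact: sqr_ge0.
Qed.

Lemma ler_normc_Im x : `|complex.Im x| <= normc x.
Proof.
case: x => a b /=; rewrite -sqrtr_sqr ler_wsqrtr // lerDr; exact: sqr_ge0.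
Qed.

Lemma normc_le_ReIm x : normc x <= `|complex.Re x| + `|complex.Im x|.
Proof.
case: x => a b /=.
rewrite -(ger0_norm (addr_ge0 (normr_ge0 a) (normr_ge0 b))) -sqrtr_sqr.
rewrite ler_wsqrtr // sqrrD !real_normK ?num_real // lerD2r lerDl.
by apply: mulrn_wge0; apply: mulr_ge0.
Qed.

Lemma normc_distC x l : normc (x - l) = normc (l - x).
Proof. by rewrite -normcN opprB. Qed.

Lemma normc_prod n u : normc (\prod_(k < n) u k) = \prod_(k < n) normc (u k).
Proof.
by elim: n => [|n IH]; rewrite ?big_ord0 ?normc1 // !big_ord_recr /= normcM IH.
Qed.

Lemma cvgc_normc_le u l (B : R) :
  u ~> l -> (forall n, normc (u n) <= B) -> normc l <= B.
Proof.
move=> /cvgcP/cvgrPdist_lt h uB; apply/ler_addgt0Pr => e e0.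
have [n _ /(_ n (leqnn n)) /=] := h _ e0.
rewrite sub0r normrN ger0_norm ?normc_ge0 // => /ltW hn.
have := ler_normcD (l - u n) (u n); rewrite subrK; have := uB n; lra.
Qed.

(** Past some index the ratios stay below the midpoint [s] of [l] and 1, so the products are
    dominated by a geometric series. *)
Lemma ratio_cvg_series r (l : R) : (forall j, 0 <= r j) ->
  r @ \oo --> l -> l < 1 -> cvgn (series (fun k => \prod_(j < k) r j)).
Proof.
move=> r0 rl l1; pose D k := \prod_(j < k) r j; pose s := (l + 1) / 2.
have s1 : s < 1 by rewrite /s; lra.
have [N _ hN] : \forall j \near \oo, r j <= s.
  by apply: (cvgr_le _ rl); rewrite /s; lra.
have s0 : 0 <= s by apply: le_trans (hN N _) => /=.
have D0 k : 0 <= D k by apply: prodr_ge0 => j _.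
have DN k : D (k + N)%N <= D N * s ^+ k.
  elim: k => [|k IH]; first by rewrite mulr1.
  rewrite /D addSn big_ord_recr /= -/(D _) exprSr mulrA ler_pM //; apply: hN => /=.
  exact: leq_addl.
have cE : cvgn (series (fun k => D (k + N)%N)).
  apply: (@series_le_cvg _ _ (geometric (D N) s)) => // [k|].
    by rewrite /= mulr_ge0 ?exprn_ge0.
  by apply: is_cvg_geometric_series; rewrite ger0_norm.
rewrite -/D -(is_cvg_series_restrict N); have /cvg_ex [a ha] := cE.
apply/cvg_ex; exists a; rewrite -(cvg_shiftn N).
suff -> : [sequence \sum_(N <= k < n + N) D k]_n = series (fun k => D (k + N)%N).
  by [].
apply/funext => n /=; rewrite /series /= -{1}[N]add0n big_addn addnK.
by [].
Qed.

Definition csum u : R[i] := limn (fun n => \sum_(k < n) u k : R[i]^o).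

(** Real and imaginary parts are absolutely convergent real series; their sums are the coordinates
    of the limit. *)
Lemma dominated_csum u D : cvgn (series D) -> (forall k, normc (u k) <= D k) ->
  (fun n => \sum_(k < n) u k) ~> csum u.
Proof.
move=> cD uD.
suff [l hl] : exists l, (fun n => \sum_(k < n) u k) ~> l.
  by rewrite /csum (cvgc_lim hl).
have D0 k : 0 <= D k by exact: le_trans (normc_ge0 _) (uD k).
have part (f : R[i] -> R) : (forall x, `|f x| <= normc x) ->
    cvgn (series (f \o u)).
  move=> fn; apply: normed_cvg; apply: series_le_cvg cD => // k /=.
    exact: normr_ge0.
  exact: le_trans (fn _) (uD k).
have /cvg_ex [a ha] := part _ ler_normc_Re.
have /cvg_ex [b hb] := part _ ler_normc_Im.
exists (a +i* b); apply/cvgcP.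
have h0 : (fun n => `|a - series (@complex.Re R \o u) n|
   + `|b - series (@complex.Im R \o u) n|) @ \oo --> (0 : R).
  rewrite -[0]addr0 -(normr0 R) -{1}(subrr a) -(subrr b).
  by apply: cvgD; apply: cvg_norm; apply: cvgB => //; exact: cvg_cst.
apply: (squeeze_cvgr _ (@cvg_cst _ 0 _ _ _) h0); apply: nearW => n.
rewrite normc_ge0 /= (le_trans (normc_le_ReIm _)) //.
have -> : \sum_(k < n) u k = (series (@complex.Re R \o u) n)
    +i* (series (@complex.Im R \o u) n).
  rewrite !seriesEord /=; elim: n => [|n IH]; first by rewrite !big_ord0.
  by rewrite !big_ord_recr /= IH; case: (u n).
by [].
Qed.

(** The bound does not depend on [u], which makes the tails in Tannery's theorem uniformly small. *)
Lemma dominated_csum_tail u D N : cvgn (series D) ->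
  (forall k, normc (u k) <= D k) ->
  normc (csum u - \sum_(k < N) u k) <= limn (series D) - series D N.
Proof.
move=> cD uD; have D0 k : 0 <= D k by exact: le_trans (normc_ge0 _) (uD k).
have nd : nondecreasing_seq (series D) by exact: nondecreasing_series.
have hu : (fun n => \sum_(k < n + N) u k - \sum_(k < N) u k)
    ~> (csum u - \sum_(k < N) u k).
  apply: cvgcB; last exact: cvgc_cst.
  by rewrite (cvgc_shiftn N (fun n => \sum_(k < n) u k)); exact: dominated_csum uD.
apply: (cvgc_normc_le hu) => n; have := nondecreasing_cvgn_le nd cD (n + N).
rewrite -(lerD2r (- series D N)); apply: le_trans.
elim: n => [|n IH]; first by rewrite add0n !subrr normc0.
rewrite addSn big_ord_recr /= seriesSr addrAC [leRHS]addrAC.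
by rewrite (le_trans (ler_normcD _ _)) // lerD.
Qed.

(** Past a common [N] both tails are below [e / 3]; the remaining finite sums converge term by
    term. *)
Lemma tannery (u : nat -> nat -> R[i]) v D : cvgn (series D) ->
  (forall m k, normc (u m k) <= D k) -> (forall k, u^~ k ~> v k) ->
  (fun m => csum (u m)) ~> csum v.
Proof.
move=> cD uD uv; have vD k : normc (v k) <= D k by exact: cvgc_normc_le (uv k) _.
apply/cvgcP/cvgrPdist_lt => e e0; have e3 : 0 < e / 3 by rewrite divr_gt0.
have [N _ /(_ N (leqnn N)) /= hN] := (cvgrPdist_lt _ _).1 cD _ e3.
have tN : limn (series D) - series D N < e / 3 by exact: le_lt_trans (ler_norm _) hN.
have uvN : (fun m => \sum_(k < N) u m k) ~> \sum_(k < N) v k.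
  elim: (N) => [|n IH].
    by apply: (cvgc_eq (@cvgc_cst _ _)) => m; rewrite !big_ord0.
  rewrite big_ord_recr; apply: (cvgc_eq (cvgcD IH (uv n))) => m.
  by rewrite big_ord_recr.
have /cvgcP/cvgrPdist_lt/(_ _ e3) := uvN; apply: filterS => m.
rewrite !sub0r !normrN !ger0_norm ?normc_ge0 // => hm.
have hv := dominated_csum_tail N cD vD; have hu := dominated_csum_tail N cD (uD m).
rewrite normc_distC in hu.
have -> : csum v - csum (u m) = (csum v - \sum_(k < N) v k)
  + ((\sum_(k < N) v k - \sum_(k < N) u m k) + (\sum_(k < N) u m k - csum (u m))).
  by ring.
apply: le_lt_trans (ler_normcD _ _) _.
have := ler_normcD (\sum_(k < N) v k - \sum_(k < N) u m k)
  (\sum_(k < N) u m k - csum (u m)).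
lra.
Qed.

End DominatedSeries.

(** * Denominators of continued fractions and convergence of approximants *)

Section ContinuedFraction.
Variable R : realType.
Implicit Types (c d e g y : nat -> R[i]) (m n : nat).

(** Eventually [u n.+1 <= z + t * u n] with a fixed [t < 1]; iteration leaves the fixed point of
    this affine map plus a geometric remainder. *)
Lemma contraction_cvg0 (u v r : nat -> R) (s : R) : (forall n, 0 <= u n) ->
  v @ \oo --> (0 : R) -> r @ \oo --> s -> 0 <= s -> s < 1 ->
  (\forall n \near \oo, u n.+1 <= v n + r n * u n) -> u @ \oo --> (0 : R).
Proof.
move=> u0 v0 rs s0 s1 hu; pose t := (s + 1) / 2.
have t1 : t < 1 by rewrite /t; lra.
have t0 : 0 < t by rewrite /t; lra.
(* [z] makes [x / 2] the fixed point of the affine map; the other half of [x] is left for the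
   remainder. *)
apply/cvgrPdist_lt => x x0; pose z := x / 2 * (1 - t).
have z0 : 0 < z by rewrite mulr_gt0 ?divr_gt0 //; lra.
have hv : \forall n \near \oo, v n <= z by apply: (cvgr_le _ v0).
have hr : \forall n \near \oo, r n <= t by apply: (cvgr_le _ rs); rewrite /t; lra.
have [N _ hN] : \forall n \near \oo, u n.+1 <= z + t * u n.
  apply: filterS3 hu hv hr => n hu hv hr; apply: le_trans hu _.
  by rewrite lerD // ler_wpM2r.
have uN k : u (k + N)%N <= x / 2 + t ^+ k * u N.
  elim: k => [|k IH]; first by rewrite mul1r add0n lerDr ltW // divr_gt0.
  rewrite addSn (le_trans (hN _ _)) /= ?leq_addl //.
  rewrite exprS -mulrA (_ : x / 2 + _ = z + t * (x / 2 + t ^+ k * u N)); last first.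
    by rewrite /z; ring.
  by rewrite lerD2l ler_wpM2l // ltW.
have hx : (fun k => t ^+ k * u N) @ \oo --> (0 : R).
  rewrite -[0](mul0r (u N)); apply: cvgMr_tmp; apply: cvg_expr.
  by rewrite gtr0_norm.
have [K _ hK] := (cvgrPdist_lt _ _).1 hx _ (divr_gt0 x0 (ltr0n _ 2)).
exists (K + N)%N => // n /= hn.
have NK : (K <= n - N)%N by rewrite leq_subRL ?(leq_trans _ hn) ?leq_addl // addnC.
have := hK _ NK; have := uN (n - N)%N; rewrite subnK ?(leq_trans _ hn) ?leq_addl //.
rewrite !sub0r !normrN (ger0_norm (u0 n)) ger0_norm; first by lra.
by rewrite mulr_ge0 ?exprn_ge0 // ltW.
Qed.

(** The limit is the fixed point of the limiting affine map. The error obeys a recurrence whose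
    factor tends to [B] and whose forcing term tends to 0. *)
Lemma contraction_cvgc y (al be : nat -> R[i]) (A B : R[i]) :
  al ~> A -> be ~> B -> normc B < 1 ->
  (\forall n \near \oo, y n.+1 = al n + be n * y n) -> y ~> (A / (1 - B)).
Proof.
move=> alA beB B1 hy; set Y := A / (1 - B).
have B10 : 1 - B != 0.
  by apply: contraTN B1; rewrite subr_eq0 => /eqP <-; rewrite normc1 ltxx.
have cB : (fun n => normc (be n)) @ \oo --> normc B.
  apply/cvgrPdist_le => x x0; have /cvgcP/cvgrPdist_le/(_ _ x0) := beB.
  apply: filterS => n; rewrite sub0r normrN ger0_norm ?normc_ge0 // => h.
  have h1 := ler_normcD (B - be n) (be n); have h2 := ler_normcD (be n - B) B.
  move: h1 h2; rewrite !subrK (normc_distC (be n)) => h1 h2.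
  by rewrite ler_norml; apply/andP; split; lra.
apply/cvgcP; apply: (@contraction_cvg0 (fun n => normc (Y - y n)) (fun n =>
  normc ((A - al n) + (B - be n) * Y)) (fun n => normc (be n)) (normc B)) => //.
- by move=> n; exact: normc_ge0.
- have : (fun n => (A - al n) + (B - be n) * Y) ~> ((A - A) + (B - B) * Y).
    exact: (cvgcD (cvgcB (@cvgc_cst R A) alA)
      (cvgcM (cvgcB (@cvgc_cst R B) beB) (@cvgc_cst R Y))).
  move=> /cvgcP; rewrite !subrr mul0r addr0.
  by under eq_fun do rewrite sub0r normcN.
- exact: normc_ge0.
- apply: filterS hy => n ->; rewrite -normcM; apply: le_trans (ler_normcD _ _).
  suff -> : Y - (al n + be n * y n)
    = (A - al n) + (B - be n) * Y + be n * (Y - y n) by [].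
  by rewrite /Y; field.
Qed.

(* Off by one: cf_den c d m n.+1 is the denominator of cf_tail c d m n. *)
Fixpoint cf_den c d m n : R[i] :=
  if n is n1.+1 then
    d m * cf_den c d m.+1 n1
    - (if n1 is n2.+1 then c m.+1 * cf_den c d m.+2 n2 else 0)
  else 1.

Lemma cf_denSS c d m n :
  cf_den c d m n.+2 = d m * cf_den c d m.+1 n.+1 - c m.+1 * cf_den c d m.+2 n.
Proof. by []. Qed.

(** That two consecutive denominators never vanish together is proved along with the formula,
    because [sdiv] sends even 0 / 0 to infinity. *)
Lemma cf_tailE c d : (forall n, c n != 0) -> forall n m,
  cf_tail c d m n = sdiv (c m * cf_den c d m.+1 n) (Some (cf_den c d m n.+1)) /\
  (cf_den c d m.+1 n != 0) || (cf_den c d m n.+1 != 0).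
Proof.
move=> c0; elim=> [|n IH] m; first by rewrite /= !mulr1 subr0 oner_neq0.
have [] := IH m.+1; rewrite [cf_tail _ _ _ n.+1]/= cf_denSS => ->.
have [-> /= | Q1 _] := eqVneq (cf_den c d m.+1 n.+1) 0; last first.
  split=> //; rewrite /sdiv (negbTE Q1) /ssub.
  set Q := cf_den c d m.+1 n.+1 in Q1 *; set Q2 := cf_den c d m.+2 n.
  have -> : d m - c m.+1 * Q2 / Q = (d m * Q - c m.+1 * Q2) / Q by field.
  rewrite mulf_eq0 invr_eq0 (negbTE Q1) orbF; case: eqVneq => // ne.
  by congr Some; rewrite invf_div mulrA.
(* Here the inner tail is infinite, so the approximant is 0; the invariant makes its denominator
   nonzero. *)
rewrite orbF eqxx /= => Q2; rewrite !mulr0 sub0r oppr_eq0.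
by rewrite mulf_eq0 (negbTE (c0 _)) (negbTE Q2) /= mul0r.
Qed.

(* If f_n = w_n g_n with w_n / w_(n+1) = e_n, the hypothesis on g reads
   f_n = d_n f_(n+1) - c_(n+1) f_(n+2). *)
Lemma cf_den_sol c d e g : (forall n, e n != 0) ->
  (forall n, e n * g n = d n * g n.+1 - c n.+1 / e n.+1 * g n.+2) ->
  forall n m, g m * \prod_(k < n.+1) e (m + k)%N = cf_den c d m n.+1 * g (m + n.+1)%N
    - c (m + n.+1)%N * cf_den c d m n * g (m + n.+2)%N / e (m + n.+1)%N.
Proof.
move=> e0 rec.
have E1 m : g m * e m = d m * g m.+1 - c m.+1 * g m.+2 / e m.+1.
  by rewrite mulrC rec mulrAC.
(* Indices [n] and [n.+1] are carried together because [cf_denSS] is a two-step recurrence. *)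
suff H n : (forall m, g m * \prod_(k < n.+1) e (m + k)%N = cf_den c d m n.+1 * g (m + n.+1)%N
    - c (m + n.+1)%N * cf_den c d m n * g (m + n.+2)%N / e (m + n.+1)%N) /\
  (forall m, g m * \prod_(k < n.+2) e (m + k)%N = cf_den c d m n.+2 * g (m + n.+2)%N
    - c (m + n.+2)%N * cf_den c d m n.+1 * g (m + n.+3)%N / e (m + n.+2)%N).
  by move=> n m; have [h _] := H n.
elim: n => [|n [IH1 IH2]].
  split=> m; first by rewrite big_ord1 !addn0 !addnS !addn0 E1 /= subr0 !mulr1.
  rewrite !big_ord_recr big_ord0 /= mul1r !addnS !addn0 mulrA E1 !subr0 !mulr1.
  have h1 := e0 m.+1; have h2 := e0 m.+2.
  by transitivity (d m * (g m.+1 * e m.+1) - c m.+1 * g m.+2); [field|rewrite E1; field].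
split=> // m; rewrite big_ord_recl addn0 mulrA E1.
have -> : \prod_(i < n.+2) e (m + lift ord0 i)%N = \prod_(i < n.+2) e (m.+1 + i)%N.
  by apply: eq_bigr => i _; rewrite /= /bump add1n addnS addSn.
rewrite mulrBl -[d m * _ * _]mulrA IH2 big_ord_recl addn0.
have -> : \prod_(i < n.+1) e (m.+1 + lift ord0 i)%N = \prod_(i < n.+1) e (m.+2 + i)%N.
  by apply: eq_bigr => i _; rewrite /= /bump add1n addnS addSn.
rewrite [X in _ - X](_ : _ = c m.+1 * (g m.+2 * \prod_(i < n.+1) e (m.+2 + i)%N)); last first.
  by have := e0 m.+1 => h; field.
rewrite IH1 [cf_den c d m n.+3]cf_denSS [cf_den c d m n.+2]cf_denSS !addSn !addnS.
by have := e0 (m + n).+3 => h; field.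
Qed.

(** Divided by the products [W] of the [e], the denominators obey an affine recurrence, read off
    from [cf_den_sol], with factor tending to [be]. Numerators are denominators of the fraction
    started one step later, so the value is a quotient of two such limits. *)
Lemma cf_value c d e g (L be : R[i]) :
  (forall n, c n != 0) -> (forall n, e n != 0) ->
  (forall n, e n * g n = d n * g n.+1 - c n.+1 / e n.+1 * g n.+2) ->
  g ~> L -> L != 0 -> (fun n => c n.+1 / (e n * e n.+1)) ~> be -> normc be < 1 ->
  g 0%N != 0 -> cf_has_value c d (Some (c 0%N * g 1%N / (e 0%N * g 0%N))).
Proof.
move=> c0 e0 rec gL L0 cbe be1 g00.
pose W m n := \prod_(k < n) e (m + k)%N.
have W0 m n : W m n != 0 by apply/prodf_neq0 => k _.
pose y m n := cf_den c d m n / W m n.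
have gm k : (fun n => g (k + n)%N) ~> L.
  elim: k => [|k IH]; first exact: gL.
  by rewrite -cvgc_shiftS in IH; apply: (cvgc_eq IH) => n; rewrite addnS.
have be10 : 1 - be != 0.
  by apply: contraTN be1; rewrite subr_eq0 => /eqP <-; rewrite normc1 ltxx.
have ylim m : y m ~> (g m / L / (1 - be)).
  have g1 := gm m; rewrite -cvgc_shiftS in g1; have g2 := g1; rewrite -cvgc_shiftS in g2.
  have ebe : (fun n => c (m + n).+1 / (e (m + n)%N * e (m + n).+1)) ~> be.
    elim: m {g1 g2} => [|m IH]; first exact: cbe.
    by rewrite -cvgc_shiftS in IH; apply: (cvgc_eq IH) => n; rewrite !addnS.
  apply: (contraction_cvgc (al := fun n => g m / g (m + n.+1)%N) (be := fun n =>
    c (m + n).+1 / (e (m + n)%N * e (m + n).+1) * (g (m + n.+2)%N / g (m + n.+1)%N))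
    _ _ be1).
  - exact: (cvgcM (@cvgc_cst R (g m)) (cvgcV L0 g1)).
  - have h := cvgcM ebe (cvgcM g2 (cvgcV L0 g1)).
    by rewrite (divff L0) mulr1 in h; exact: h.
  apply: filterS (cvgc_near_neq0 g1 L0) => n gn0.
  have := cf_den_sol e0 rec n m; rewrite -/(W m n.+1) /y.
  rewrite [W m n.+1]big_ord_recr -/(W m n) [_ (W m n) _]/= !addnS => E.
  have Wn := W0 m n; have en := e0 (m + n)%N; have en1 := e0 (m + n).+1.
  rewrite addnS in gn0.
  have -> : cf_den c d m n.+1 = (g m * (W m n * e (m + n)%N)
      + c (m + n).+1 * cf_den c d m n * g (m + n).+2 / e (m + n).+1) / g (m + n).+1.
    by rewrite E subrK mulfK.
  by field; rewrite gn0 en1 en Wn.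
have y0 := ylim 0%N; rewrite -cvgc_shiftS in y0; have y1 := ylim 1%N.
(* As [g 0] is nonzero, the scaled denominators are eventually nonzero and the approximants
   eventually finite. *)
have yL0 : g 0%N / L / (1 - be) != 0.
  by rewrite !mulf_neq0 ?invr_neq0.
rewrite /cf_has_value.
have hlim : (fun n => c 0%N / e 0%N * (y 1%N n / y 0%N n.+1)) ~>
    (c 0%N * g 1%N / (e 0%N * g 0%N)).
  have -> : c 0%N * g 1%N / (e 0%N * g 0%N)
    = c 0%N / e 0%N * ((g 1%N / L / (1 - be)) / (g 0%N / L / (1 - be))).
    by have := e0 0%N => h; field; rewrite h g00 L0 be10.
  exact: (cvgcM (@cvgc_cst R _) (cvgcM y1 (cvgcV yL0 y0))).
apply: (cvgc_sphere hlim); apply: filterS (cvgc_near_neq0 y0 yL0) => n yn.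
have [-> _] := cf_tailE d c0 n 0%N.
have Q0 : cf_den c d 0 n.+1 != 0 by apply: contraNneq yn => h; rewrite /y h mul0r.
rewrite /sdiv (negbTE Q0); congr Some; rewrite /y.
(* [W 0] has one more initial factor than [W 1]; this accounts for the division by [e 0] in the
   value. *)
have -> : W 0%N n.+1 = e 0%N * W 1%N n.
  rewrite /W big_ord_recl addn0; congr (_ * _); exact: eq_bigr.
have := e0 0%N; have := W0 1%N n => h1 h2; field.
by rewrite h1 h2 Q0.
Qed.

End ContinuedFraction.

(** * Series given by term ratios, and contiguous relations *)

Section HypergeometricSums.
Variable R : realType.
Implicit Types (rho : nat -> R[i]) (r : nat -> R) (x y z q : R[i]).

(** Encoding a hypergeometric series by its term ratios avoids parameters such as b/a and reduces
    convergence to a limit of ratios. *)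
Definition hsum rho : R[i] := csum (fun k => \prod_(j < k) rho j).

Lemma normc_prod_le rho r : (forall j, normc (rho j) <= r j) ->
  forall k, normc (\prod_(j < k) rho j) <= \prod_(j < k) r j.
Proof.
move=> h k; rewrite normc_prod; apply: ler_prod => j _.
by rewrite normc_ge0 h.
Qed.

Lemma hsum_cvg rho r (l : R) : (forall j, normc (rho j) <= r j) ->
  r @ \oo --> l -> l < 1 ->
  (fun n => \sum_(k < n) \prod_(j < k) rho j) ~> hsum rho.
Proof.
move=> rho_r rl l1; apply: (dominated_csum _ (normc_prod_le rho_r)).
by apply: ratio_cvg_series rl l1 => j; exact: le_trans (normc_ge0 _) (rho_r j).
Qed.

Lemma hsum_tannery (rho : nat -> nat -> R[i]) (sigma : nat -> R[i]) r (l : R) :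
  (forall m j, normc (rho m j) <= r j) -> r @ \oo --> l -> l < 1 ->
  (forall j, rho^~ j ~> sigma j) -> (fun m => hsum (rho m)) ~> hsum sigma.
Proof.
move=> rho_r rl l1 rho_sigma.
apply: (@tannery _ (fun m k => \prod_(j < k) rho m j) (fun k => \prod_(j < k) sigma j)
  (fun k => \prod_(j < k) r j)).
- by apply: ratio_cvg_series rl l1 => j; exact: le_trans (normc_ge0 _) (rho_r 0%N j).
- by move=> m k; apply: normc_prod_le.
elim=> [|k IH].
  by apply: (cvgc_eq (@cvgc_cst R _)) => m; rewrite !big_ord0.
by rewrite big_ord_recr; apply: (cvgc_eq (cvgcM IH (rho_sigma k))) => m; rewrite big_ord_recr.
Qed.

Lemma hsum0 : hsum (fun=> 0) = 1.
Proof.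
apply: cvgc_lim; rewrite -cvgc_shiftS; apply: (cvgc_eq (@cvgc_cst R 1)) => n.
elim: n => [|n IH]; first by rewrite big_ord1 big_ord0.
by rewrite big_ord_recr /= -IH big_ord_recl mul0r addr0.
Qed.

(** Relations between series reduce to relations between coefficients: the weights [x] act at index
    [k.+1], the weights [y] at index [k], and summation over [k] merges them. *)
Lemma csum_contiguous (t0 t1 t2 : nat -> R[i]) (x0 x1 x2 y0 y1 y2 s0 s1 s2 : R[i]) :
  (fun n => \sum_(k < n) t0 k) ~> s0 ->
  (fun n => \sum_(k < n) t1 k) ~> s1 ->
  (fun n => \sum_(k < n) t2 k) ~> s2 ->
  x0 * t0 0%N + x1 * t1 0%N + x2 * t2 0%N = 0 ->
  (forall k, x0 * t0 k.+1 + x1 * t1 k.+1 + x2 * t2 k.+1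
    + (y0 * t0 k + y1 * t1 k + y2 * t2 k) = 0) ->
  (x0 + y0) * s0 + (x1 + y1) * s1 + (x2 + y2) * s2 = 0.
Proof.
move=> h0 h1 h2 e0 eS.
have part (t : nat -> R[i]) x y s : (fun n => \sum_(k < n) t k) ~> s ->
    (fun n => x * \sum_(k < n.+1) t k + y * \sum_(k < n) t k) ~> ((x + y) * s).
  move=> h; rewrite mulrDl; have hS := h; rewrite -cvgc_shiftS in hS.
  exact: (cvgcD (cvgcM (@cvgc_cst R x) hS) (cvgcM (@cvgc_cst R y) h)).
have H := cvgcD (cvgcD (part _ x0 y0 _ h0) (part _ x1 y1 _ h1)) (part _ x2 y2 _ h2).
apply: (cvgc_unique H); apply: (cvgc_eq (@cvgc_cst R 0)) => n.
elim: n => [|n IH]; first by rewrite !big_ord1 !big_ord0 !mulr0 !addr0 e0.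
rewrite !(big_ord_recr n.+1) !(big_ord_recr n) /= in IH *.
by rewrite -[LHS]addr0 -{1}(eS n) {1}IH; ring.
Qed.

(** * The q-binomial theorem and infinite q-products *)

Lemma onem_neq0 x : normc x < 1 -> 1 - x != 0.
Proof. by apply: contraTN; rewrite subr_eq0 => /eqP <-; rewrite normc1 ltxx. Qed.

Lemma normcX_lt1 q n : normc q < 1 -> normc (q ^+ n.+1) < 1.
Proof. by move=> q1; rewrite normcX exprn_ilt1 ?normc_ge0. Qed.

Lemma normcX_le1 q n : normc q < 1 -> normc (q ^+ n) <= 1.
Proof. by move=> q1; rewrite normcX exprn_ile1 ?normc_ge0 // ltW. Qed.

Lemma ler_normcB x y : normc (x - y) <= normc x + normc y.
Proof. by rewrite -(normcN y) ler_normcD. Qed.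

Lemma normc_onem_ge x (g : R) : normc x <= g -> 1 - g <= normc (1 - x).
Proof.
by move=> xg; have := ler_normcD (1 - x) x; rewrite subrK normc1; lra.
Qed.

(* 1phi0(y/x; q; x), in a form that also makes sense for x = 0. *)
Definition qbin x y q : R[i] := hsum (fun j => (x - y * q ^+ j) / (1 - q ^+ j.+1)).

(** A majorant shared by all parameters of smaller modulus, in particular by every pair
    [x * q ^+ n], [y * q ^+ n]. *)
Definition qbin_bound x y q (j : nat) : R :=
  (normc x + normc y * normc q ^+ j) / (1 - normc q ^+ j.+1).

Lemma qbin_boundP x y q z w (j : nat) : normc q < 1 ->
  normc z <= normc x -> normc w <= normc y ->
  normc ((z - w * q ^+ j) / (1 - q ^+ j.+1)) <= qbin_bound x y q j.
Proof.
move=> q1 zx wy; rewrite normcM normcV /qbin_bound.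
have Q1 : 0 < 1 - normc q ^+ j.+1 by rewrite -normcX subr_gt0 normcX_lt1.
apply: ler_pM; rewrite ?normc_ge0 ?invr_ge0 ?normc_ge0 //.
  rewrite (le_trans (ler_normcB _ _)) // normcM normcX lerD // ler_wpM2r //.
  by rewrite exprn_ge0 ?normc_ge0.
have h : 1 - normc q ^+ j.+1 <= normc (1 - q ^+ j.+1).
  by apply: normc_onem_ge; rewrite normcX.
by rewrite lef_pV2 ?posrE // (lt_le_trans Q1).
Qed.

Lemma cvg_normcX q : normc q < 1 -> (fun j => normc q ^+ j) @ \oo --> (0 : R).
Proof. by move=> q1; apply: cvg_expr; rewrite ger0_norm ?normc_ge0. Qed.

Lemma cvg_normcXS q : normc q < 1 -> (fun j => normc q ^+ j.+1) @ \oo --> (0 : R).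
Proof.
by move=> q1; rewrite (cvg_shiftS (fun j => normc q ^+ j)); exact: cvg_normcX.
Qed.

Lemma cvg_qbin_bound x y q : normc q < 1 -> qbin_bound x y q @ \oo --> normc x.
Proof.
move=> q1; have -> : normc x = (normc x + normc y * 0) / (1 - 0).
  by rewrite mulr0 addr0 subr0 divr1.
apply: cvgM.
  by apply: cvgD; [exact: cvg_cst|apply: cvgMl_tmp; exact: cvg_normcX].
apply: cvgV; first by rewrite subr0 oner_neq0.
by apply: cvgB; [exact: cvg_cst|exact: cvg_normcXS].
Qed.

Lemma qbin_cvg x y q : normc q < 1 -> normc x < 1 ->
  (fun n => \sum_(k < n) \prod_(j < k) ((x - y * q ^+ j) / (1 - q ^+ j.+1)))
    ~> qbin x y q.
Proof.
move=> q1 x1; have h j := @qbin_boundP x y q x y j q1 (lexx _) (lexx _).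
exact: (hsum_cvg h (@cvg_qbin_bound x y q q1) x1).
Qed.

Lemma qbin_step x y q : normc q < 1 -> normc x < 1 ->
  (1 - x) * qbin x y q = (1 - y) * qbin (x * q) (y * q) q.
Proof.
move=> q1 x1; have xq1 : normc (x * q) < 1.
  by rewrite normcM mulr_ilt1 ?normc_ge0.
set t := fun k => \prod_(j < k) ((x - y * q ^+ j) / (1 - q ^+ j.+1)).
set t' := fun k => \prod_(j < k) ((x * q - y * q * q ^+ j) / (1 - q ^+ j.+1)).
have tt' k : t' k = q ^+ k * t k.
  elim: k => [|k IH]; first by rewrite /t' /t !big_ord0 mulr1 expr0.
  rewrite /t' /t !big_ord_recr /= -/(t k) -/(t' k) IH exprS.
  by have := onem_neq0 (normcX_lt1 k q1); rewrite exprS => h; field.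
(* The coefficient identity is [(1 - q ^+ k.+1) * t k.+1 = (x - y * q ^+ k) * t k]; the third series
   is a placeholder of weight 0. *)
have := @csum_contiguous t t' t' 1 (-1) 0 (- x) y 0 _ _ _ (qbin_cvg y q1 x1)
  (qbin_cvg (y * q) q1 xq1) (qbin_cvg (y * q) q1 xq1).
rewrite !tt' expr0 !mul1r !mulN1r !mul0r !addr0 subrr => /(_ erefl) H.
apply/eqP; rewrite -subr_eq0; apply/eqP; rewrite -[RHS]H; first by ring.
move=> k; rewrite !tt' !mul0r !addr0 /t big_ord_recr /= -/(t k) exprS.
have := onem_neq0 (normcX_lt1 k q1); rewrite exprS => h; field.
by rewrite h.
Qed.

Lemma qbin_prod x y q n : normc q < 1 -> normc x < 1 ->
  qbin x y q * \prod_(k < n) (1 - x * q ^+ k)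
    = \prod_(k < n) (1 - y * q ^+ k) * qbin (x * q ^+ n) (y * q ^+ n) q.
Proof.
move=> q1 x1; elim: n => [|n IH]; first by rewrite !big_ord0 !mulr1 mul1r.
have xn : normc (x * q ^+ n) < 1.
  by rewrite normcM (le_lt_trans _ x1) // ler_piMr ?normc_ge0 // normcX_le1.
rewrite !big_ord_recr /= mulrA IH !exprSr !mulrA -[RHS]mulrA.
by rewrite -(qbin_step _ q1 xn); ring.
Qed.

Lemma qbin_cvg1 x y q : normc q < 1 -> normc x < 1 ->
  (fun n => qbin (x * q ^+ n) (y * q ^+ n) q) ~> 1.
Proof.
move=> q1 x1; rewrite -hsum0.
apply: (@hsum_tannery (fun n j => (x * q ^+ n - y * q ^+ n * q ^+ j) / (1 - q ^+ j.+1))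
  _ _ _ _ (@cvg_qbin_bound x y q q1) x1).
  move=> m j; apply: qbin_boundP => //; rewrite normcM ler_piMr ?normc_ge0 //;
    exact: normcX_le1.
move=> j.
have X (z : R[i]) : (fun n => z * q ^+ n) ~> (z * 0).
  exact: (cvgcM (@cvgc_cst R z) (cvgc_X q1)).
have := cvgcM (cvgcB (X x) (cvgcM (X y) (@cvgc_cst R (q ^+ j))))
  (@cvgc_cst R (1 - q ^+ j.+1)^-1).
by rewrite !(mulr0, mul0r) subrr mul0r.
Qed.

(** At [y = 0], [qbin_prod] says that the series times the partial product is the shifted series,
    which tends to 1. Hence the series is nonzero and the product tends to its inverse. *)
Lemma qpoch_partial_cvg x q : normc q < 1 -> normc x < 1 ->
  exists2 l, l != 0 & (fun n => \prod_(k < n) (1 - x * q ^+ k)) ~> l.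
Proof.
move=> q1 x1; have h1 := qbin_cvg1 0 q1 x1.
have E n : qbin x 0 q * \prod_(k < n) (1 - x * q ^+ k)
    = qbin (x * q ^+ n) (0 * q ^+ n) q.
  rewrite qbin_prod // big1 ?mul1r // => k _.
  by rewrite mul0r subr0.
have S0 : qbin x 0 q != 0.
  apply/eqP => S0; have /eqP := oner_neq0 R[i]; apply.
  apply: (cvgc_unique h1); apply: (cvgc_eq (@cvgc_cst R 0)) => n.
  by rewrite -E S0 mul0r.
exists (1 / qbin x 0 q); first by rewrite mul1r invr_neq0.
apply: (cvgc_eq (cvgcM h1 (@cvgc_cst R (qbin x 0 q)^-1))) => n.
by rewrite -E mulrAC divff // mul1r.
Qed.

Lemma qpoch_cvg x q : normc q < 1 ->
  (fun n => \prod_(k < n) (1 - x * q ^+ k)) ~> qpoch x q.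
Proof.
move=> q1.
suff [l hl] : exists l, (fun n => \prod_(k < n) (1 - x * q ^+ k)) ~> l.
  by rewrite /qpoch (cvgc_lim hl).
have h0 : (fun n => x * q ^+ n) ~> 0.
  by rewrite -(mulr0 x); exact: (cvgcM (@cvgc_cst R x) (cvgc_X q1)).
(* Finitely many factors are split off to bring the argument into the unit disk. *)
have [N xN] : exists N, normc (x * q ^+ N) < 1.
  have /cvgcP/cvgrPdist_lt/(_ _ ltr01) [N _ hN] := h0.
  exists N; have := hN N (leqnn N).
  by rewrite /= !sub0r normcN normrN ger0_norm ?normc_ge0.
have [l _ hl] := qpoch_partial_cvg q1 xN.
exists (\prod_(k < N) (1 - x * q ^+ k) * l); rewrite -(cvgc_shiftn N).
apply: (cvgc_eq (cvgcM (@cvgc_cst R _) hl)) => n.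
rewrite addnC big_split_ord /=; congr (_ * _); apply: eq_bigr => k _.
by rewrite exprD mulrA.
Qed.

Lemma qpoch_neq0 x q : normc q < 1 -> normc x < 1 -> qpoch x q != 0.
Proof.
move=> q1 x1; have [l l0 hl] := qpoch_partial_cvg q1 x1.
by rewrite -(cvgc_unique hl (qpoch_cvg x q1)).
Qed.

(** The limit of [qbin_prod], where the shifted series tends to 1. *)
Lemma q_binomial x y q : normc q < 1 -> normc x < 1 ->
  qbin x y q * qpoch x q = qpoch y q.
Proof.
move=> q1 x1.
apply: (cvgc_unique (cvgcM (@cvgc_cst R (qbin x y q)) (qpoch_cvg x q1))).
have := cvgcM (qpoch_cvg y q1) (qbin_cvg1 y q1 x1); rewrite mulr1 => h.
by apply: (cvgc_eq h) => n; rewrite qbin_prod.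
Qed.

End HypergeometricSums.

(** * Heine series and their three-term relations *)

Section HeineSeries.
Variables (R : realType) (a b q p : R[i]).
Hypotheses (q1 : normc q < 1) (p1 : normc p < 1) (a1 : normc (a ^+ 2) < 1).

(* Term ratios of 2phi1(bq/a, b p^i/a; q p^i; p; a^2 p^m), also valid for a = 0. *)
Definition heine_ratio (i m j : nat) : R[i] :=
  (a - b * q * p ^+ j) * (a - b * p ^+ (i + j)) * p ^+ m
  / ((1 - q * p ^+ (i + j)) * (1 - p ^+ j.+1)).

Definition heine (i m : nat) : R[i] := hsum (heine_ratio i m).

Let t (i m k : nat) : R[i] := \prod_(j < k) heine_ratio i m j.

Let qp_lt1 n : normc (q * p ^+ n) < 1.
Proof.
by rewrite normcM (le_lt_trans _ q1) // ler_piMr ?normc_ge0 // normcX_le1.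
Qed.

Let qp_neq0 n : 1 - q * p ^+ n != 0. Proof. exact: onem_neq0. Qed.

Let p_neq0 n : 1 - p ^+ n.+1 != 0. Proof. by apply: onem_neq0; exact: normcX_lt1. Qed.

(** A majorant of the term ratios uniform in [i] and [m]. Its limit is below 1 by [a1], so limits in
    [i] and [m] may be taken inside the series. *)
Let bound (j : nat) : R :=
  (normc a + normc b * normc p ^+ j) ^+ 2
  / ((1 - normc q * normc p ^+ j) * (1 - normc p ^+ j.+1)).

Let bound_cvg : bound @ \oo --> normc (a ^+ 2).
Proof.
have -> : normc (a ^+ 2) = (normc a + normc b * 0) ^+ 2 / ((1 - normc q * 0) * (1 - 0)).
  by rewrite normcX !mulr0 addr0 !subr0 mulr1 divr1.
have pj := cvg_normcX p1; have pS := cvg_normcXS p1.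
have c1 : (fun j => normc a + normc b * normc p ^+ j) @ \oo --> normc a + normc b * 0.
  by apply: cvgD; [exact: cvg_cst|exact: cvgMl_tmp].
have c2 : (fun j => 1 - normc q * normc p ^+ j) @ \oo --> 1 - normc q * 0.
  by apply: cvgB; [exact: cvg_cst|exact: cvgMl_tmp].
have c3 : (fun j => 1 - normc p ^+ j.+1) @ \oo --> (1 - 0 : R).
  by apply: cvgB; [exact: cvg_cst|].
rewrite expr2; under [bound]eq_fun do rewrite /bound expr2.
apply: cvgM; first exact: cvgM.
by apply: cvgV; [rewrite mulr0 !subr0 mulr1 oner_neq0|exact: cvgM].
Qed.

Let ratio_bound i m j : normc (heine_ratio i m j) <= bound j.
Proof.
have P0 : 0 <= normc p ^+ j by rewrite exprn_ge0 ?normc_ge0.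
have P1 : normc p ^+ j <= 1 by rewrite -(normcX p) normcX_le1.
have Q1 : 0 < 1 - normc p ^+ j.+1 by rewrite -(normcX p) subr_gt0 normcX_lt1.
have G1 : 0 < 1 - normc q * normc p ^+ j.
  by rewrite subr_gt0 (le_lt_trans _ q1) // ler_piMr ?normc_ge0.
have pij : normc (p ^+ (i + j)) <= normc p ^+ j.
  by rewrite exprD normcM (normcX p j) ler_piMl // normcX_le1.
rewrite /heine_ratio /bound normcM normcV !normcM; apply: ler_pM.
- by rewrite !mulr_ge0 ?normc_ge0.
- by rewrite invr_ge0 mulr_ge0 ?normc_ge0.
- rewrite (expr2 (_ + _)) -[leRHS]mulr1; apply: ler_pM; rewrite ?mulr_ge0 ?normc_ge0 //.
    apply: ler_pM; rewrite ?normc_ge0 // (le_trans (ler_normcB _ _)) // lerD2l.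
      rewrite (normcM _ (p ^+ j)) (normcM b) (normcX p) ler_wpM2r //.
      by rewrite ler_piMr ?normc_ge0 //; exact: ltW.
    by rewrite normcM ler_wpM2l ?normc_ge0.
  exact: normcX_le1.
have h1 : 1 - normc q * normc p ^+ j <= normc (1 - q * p ^+ (i + j)).
  by apply: normc_onem_ge; rewrite normcM ler_wpM2l ?normc_ge0.
have h2 : 1 - normc p ^+ j.+1 <= normc (1 - p ^+ j.+1).
  by apply: normc_onem_ge; rewrite (normcX p).
have D1 := mulr_gt0 G1 Q1.
have D2 := mulr_gt0 (lt_le_trans G1 h1) (lt_le_trans Q1 h2).
by rewrite lef_pV2 ?posrE //; apply: ler_pM => //; exact: ltW.
Qed.

Lemma heine_cvg i m : (fun n => \sum_(k < n) t i m k) ~> heine i m.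
Proof. exact: (hsum_cvg (ratio_bound i m) bound_cvg a1). Qed.

Lemma heine_lim (u v : nat -> nat) (sigma : nat -> R[i]) :
  (forall j, (fun n => heine_ratio (u n) (v n) j) ~> sigma j) ->
  (fun n => heine (u n) (v n)) ~> hsum sigma.
Proof.
exact: (hsum_tannery (fun n => ratio_bound (u n) (v n)) bound_cvg a1).
Qed.

Let tS i m k : t i m k.+1 = t i m k * heine_ratio i m k.
Proof. by rewrite /t big_ord_recr. Qed.

Let t_m i m k : t i m.+1 k = p ^+ k * t i m k.
Proof.
elim: k => [|k IH]; first by rewrite /t !big_ord0 mulr1.
by rewrite !tS IH /heine_ratio !exprS; ring.
Qed.

(** Raising [i] drops the first factor and appends a new last one in both shifted factorials;
    denominators are cleared since [a - b * p ^+ i] may vanish. *)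
Let t_i i m k : (a - b * p ^+ i) * (1 - q * p ^+ (i + k)) * t i.+1 m k
  = (1 - q * p ^+ i) * (a - b * p ^+ (i + k)) * t i m k.
Proof.
elim: k => [|k IH]; first by rewrite /t !big_ord0 addn0; ring.
rewrite !tS /heine_ratio.
have h1 := qp_neq0 (i + k); have h2 := qp_neq0 (i + k.+1); have h3 := p_neq0 k.
move: h1 h2 h3 IH; rewrite ?addSn !addnS.
set A := a - _; set B := 1 - q * p ^+ (i + k); set C := a - b * p ^+ (i + k).
set D := 1 - q * p ^+ i; set B' := 1 - q * p ^+ (i + k).+1.
set C' := a - b * p ^+ (i + k).+1; set E := 1 - p ^+ k.+1 => h1 h2 h3 IH.
transitivity (A * B * t i.+1 m k * ((a - b * q * p ^+ k) * C' * p ^+ m / (B * E))).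
  by field; rewrite h1 h2 h3.
by rewrite IH; field; rewrite h1 h3.
Qed.

(** Expresses a term at [k.+1] through the series with [i] raised at [k], so that contiguous
    relations can be compared on one common term. *)
Let t_ir i m k : (1 - q * p ^+ i) * t i m k.+1
  = (a - b * p ^+ i) * (a - b * q * p ^+ k) * p ^+ m / (1 - p ^+ k.+1) * t i.+1 m k.
Proof.
rewrite tS /heine_ratio; have h1 := qp_neq0 (i + k); have h3 := p_neq0 k.
apply: (mulIf h1); transitivity (((1 - q * p ^+ i) * (a - b * p ^+ (i + k)) * t i m k)
  * ((a - b * q * p ^+ k) * p ^+ m / (1 - p ^+ k.+1))).
  by field; rewrite h1 h3.
by rewrite -t_i; field; rewrite h3.
Qed.

(** By [t_m] and [t_ir] all terms are multiples of [t i.+1 m k], which leaves a rational identity.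
    For [i = m] it is the step at even indices in case (ii). *)
Lemma heine_rec_even i m : (1 - q * p ^+ i) * heine i m =
  (1 - a * b * p ^+ (i + m)) * heine i.+1 m
  - (1 - b ^+ 2 * p ^+ m) * (q * p ^+ i) * heine i.+1 m.+1.
Proof.
(* [t i m k] is homogeneous of degree [2 * k] in [a] and [b], so coefficients of degree 0 go with
   index [k.+1] and those of degree 2 with index [k]. *)
have := @csum_contiguous R (t i m) (t i.+1 m) (t i.+1 m.+1)
  (1 - q * p ^+ i) (-1) (q * p ^+ i) 0 (a * b * p ^+ (i + m))
  (- (b ^+ 2 * p ^+ m * (q * p ^+ i))) _ _ _ (heine_cvg i m) (heine_cvg i.+1 m)
  (heine_cvg i.+1 m.+1).
rewrite {1 2 3}/t !big_ord0 => H.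
apply/eqP; rewrite -subr_eq0; apply/eqP; rewrite -[RHS]H; [ring|ring|] => k.
rewrite !t_m t_ir !tS /heine_ratio !exprD !exprS.
have := qp_neq0 (i.+1 + k); have := p_neq0 k; rewrite !exprD !exprS => h1 h2.
by field; rewrite h1 h2.
Qed.

Lemma heine_rec_odd m : (1 - a ^+ 2 * p ^+ m) * heine m.+1 m =
  (1 - a * b * p ^+ (m + m).+1) * heine m.+1 m.+1
  - (a - b * p ^+ m.+1) * (b - a * p ^+ m.+1) * (q * p ^+ m)
    / (1 - q * p ^+ m.+1) * heine m.+2 m.+1.
Proof.
have := @csum_contiguous R (t m.+1 m) (t m.+1 m.+1) (t m.+2 m.+1)
  1 (-1) 0 (- (a ^+ 2 * p ^+ m)) (a * b * p ^+ (m + m).+1)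
  ((a - b * p ^+ m.+1) * (b - a * p ^+ m.+1) * (q * p ^+ m) / (1 - q * p ^+ m.+1))
  _ _ _ (heine_cvg m.+1 m) (heine_cvg m.+1 m.+1) (heine_cvg m.+2 m.+1).
rewrite {1 2 3}/t !big_ord0 => H; have h2 := qp_neq0 m.+1.
apply/eqP; rewrite -subr_eq0; apply/eqP; rewrite -[RHS]H; [by field|by ring|] => k.
have h1 := qp_neq0 (m.+1 + k); have h3 := p_neq0 k.
(* [t_i] lowers the first index of the last series, so that only [t m.+1 m k] remains. *)
have E : (a - b * p ^+ m.+1) * (b - a * p ^+ m.+1) * (q * p ^+ m)
    / (1 - q * p ^+ m.+1) * t m.+2 m.+1 k
  = (b - a * p ^+ m.+1) * (q * p ^+ m) * (a - b * p ^+ (m.+1 + k))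
    / (1 - q * p ^+ (m.+1 + k)) * t m.+1 m.+1 k.
  transitivity ((b - a * p ^+ m.+1) * (q * p ^+ m) / (1 - q * p ^+ m.+1)
    / (1 - q * p ^+ (m.+1 + k))
    * ((a - b * p ^+ m.+1) * (1 - q * p ^+ (m.+1 + k)) * t m.+2 m.+1 k)).
    by field; rewrite h1 h2.
  by rewrite t_i; field; rewrite h1 h2.
rewrite E mul0r !t_m !tS /heine_ratio.
move: h1 h2 h3; rewrite !exprD !exprS !exprD => h1 h2 h3.
by field; rewrite h1 h3.
Qed.

(** The recurrence of case (i). In the coefficient identity the [a ^+ 2] part leaves a factor
    [q ^+ 2 - p], which is where the base enters. *)
Lemma heine_rec_m0 i : p = q ^+ 2 -> q * (1 - q * p ^+ i) * heine i 0 =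
  (a * b + q) * (1 - q * p ^+ i) * heine i.+1 0
  - (a - b * p ^+ i.+1) * (b - a * p ^+ i.+1) / (1 - q * p ^+ i.+1) * heine i.+2 0.
Proof.
move=> pq; have := @csum_contiguous R (t i 0) (t i.+1 0) (t i.+2 0)
  (q * (1 - q * p ^+ i)) (- (q * (1 - q * p ^+ i))) 0 0 (- (a * b * (1 - q * p ^+ i)))
  ((a - b * p ^+ i.+1) * (b - a * p ^+ i.+1) / (1 - q * p ^+ i.+1))
  _ _ _ (heine_cvg i 0) (heine_cvg i.+1 0) (heine_cvg i.+2 0).
rewrite {1 2 3}/t !big_ord0 => H; have h2 := qp_neq0 i.+1.
apply/eqP; rewrite -subr_eq0; apply/eqP; rewrite -[RHS]H; [by field|by ring|] => k.
have h1 := qp_neq0 (i.+1 + k); have h3 := p_neq0 k.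
have E : (a - b * p ^+ i.+1) * (b - a * p ^+ i.+1) / (1 - q * p ^+ i.+1) * t i.+2 0 k
  = (b - a * p ^+ i.+1) * (a - b * p ^+ (i.+1 + k)) / (1 - q * p ^+ (i.+1 + k)) * t i.+1 0 k.
  transitivity ((b - a * p ^+ i.+1) / (1 - q * p ^+ i.+1) / (1 - q * p ^+ (i.+1 + k))
    * ((a - b * p ^+ i.+1) * (1 - q * p ^+ (i.+1 + k)) * t i.+2 0 k)).
    by field; rewrite h1 h2.
  by rewrite t_i; field; rewrite h1 h2.
rewrite E -[q * _ * _]mulrA t_ir [t i.+1 0 k.+1]tS /heine_ratio.
move: h1 h3; rewrite !exprD !exprS expr0; move: (p ^+ i) (p ^+ k) => P K.
rewrite pq => h1 h3; by field; rewrite h1 h3.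
Qed.

End HeineSeries.

(** * Splitting the q-binomial series into two Heine series *)

Section QuotientOfProducts.
Variables (R : realType) (a b q : R[i]).
Hypotheses (q1 : normc q < 1) (a1 : normc (a ^+ 2) < 1).
Local Notation F := (heine a b q (q ^+ 2)).

Let p1 : normc (q ^+ 2) < 1. Proof. exact: normcX_lt1. Qed.

Lemma normc_sqr_lt1 (x : R[i]) : normc (x ^+ 2) < 1 -> normc x < 1.
Proof. by rewrite normcX expr_lt1 // normc_ge0. Qed.

(** Two consecutive term ratios in base [q] multiply to one Heine ratio in base [q ^+ 2]; terms of
    even index give [F 0 0], those of odd index [F 1 0]. *)
Lemma qbin_heine : qbin a b q = F 0 0 + (a - b) / (1 - q) * F 1 0.
Proof.
pose s k := \prod_(j < k) ((a - b * q ^+ j) / (1 - q ^+ j.+1)).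
pose t i k := \prod_(j < k) heine_ratio a b q (q ^+ 2) i 0 j.
have q0 n : 1 - q ^+ n.+1 != 0 by apply: onem_neq0; exact: normcX_lt1.
have pk n : (q ^+ 2) ^+ n = q ^+ n.*2 by rewrite -exprM mul2n.
have st k : s k.*2 = t 0%N k /\ s k.*2.+1 = (a - b) / (1 - q) * t 1%N k.
  have sS n : s n.+1 = s n * ((a - b * q ^+ n) / (1 - q ^+ n.+1)).
    by rewrite /s big_ord_recr.
  have tS i n : t i n.+1 = t i n * heine_ratio a b q (q ^+ 2) i 0 n.
    by rewrite /t big_ord_recr.
  elim: k => [|k [IH0 IH1]].
    by rewrite sS /s /t !big_ord0 expr0 expr1 mul1r !mulr1.
  have E : s k.+1.*2 = t 0%N k.+1.
    have := q0 k.*2; have := q0 k.*2.+1.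
    rewrite doubleS !sS IH0 tS /heine_ratio add0n !pk doubleS !exprS expr0.
    by move=> h1 h2; field; rewrite h1 h2.
  split=> //; have := q0 k.*2; have := q0 k.*2.+1; have := q0 k.*2.+2; have := q0 0%N.
  rewrite sS doubleS !sS IH0 tS /heine_ratio.
  rewrite (_ : t 0%N k = s k.*2) // [_ * (t 1%N k * _)]mulrA -IH1.
  rewrite sS add1n !pk doubleS !exprS expr0 => h0 h1 h2 h3.
  by field; rewrite ?h1 ?h2 ?h3 //.
have hF i := heine_cvg b q1 p1 a1 i 0.
apply: (cvgc_unique (qbin_cvg b q1 (normc_sqr_lt1 a1))).
have S n : \sum_(k < n.*2) s k
    = \sum_(k < n) t 0%N k + (a - b) / (1 - q) * \sum_(k < n) t 1%N k.
  elim: n => [|n IH]; first by rewrite !big_ord0 mulr0 addr0.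
  rewrite doubleS !(big_ord_recr _.+1) !(big_ord_recr n) (big_ord_recr n.*2) /= IH.
  by have [-> ->] := st n; ring.
apply: cvgc_even_odd.
  apply: (cvgc_eq (cvgcD (hF 0%N) (cvgcM (@cvgc_cst R _) (hF 1%N)))) => n.
  by rewrite S.
have h0 := hF 0%N; rewrite -cvgc_shiftS in h0.
apply: (cvgc_eq (cvgcD h0 (cvgcM (@cvgc_cst R _) (hF 1%N)))) => n.
rewrite big_ord_recr (big_ord_recr n.*2) /= S -/(s n.*2).
by have [-> _] := st n; rewrite /t; ring.
Qed.

End QuotientOfProducts.

(** Term ratios are homogeneous of degree 2 in [a] and [b]. *)
Lemma heineN (R : realType) (a b q p : R[i]) i m :
  heine (- a) (- b) q p i m = heine a b q p i m.
Proof. by congr hsum; apply/funext => j; rewrite /heine_ratio; congr (_ / _); ring. Qed.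

(** * Values of the two continued fractions *)

Section Values.
Variables (R : realType) (a b q : R[i]).
Hypotheses (q1 : normc q < 1) (a1 : normc (a ^+ 2) < 1).
Hypothesis den : qpoch2 (- a) b q + qpoch2 a (- b) q != 0.
Local Notation F := (heine a b q (q ^+ 2)).

Let p1 : normc (q ^+ 2) < 1. Proof. exact: normcX_lt1. Qed.

(** By the q-binomial theorem at [(a, b)] and [(- a, - b)], the two products are
    [qpoch a q * qpoch (- a) q] times [F 0 0] plus or minus the [F 1 0] term. Sum and difference
    isolate each, and [den] forces [F 0 0] to be nonzero. *)
Lemma qpoch2_heine : F 0 0 != 0 /\
  (qpoch2 (- a) b q - qpoch2 a (- b) q) / (qpoch2 (- a) b q + qpoch2 a (- b) q)
    = (a - b) / (1 - q) * F 1 0 / F 0 0.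
Proof.
have an1 : normc ((- a) ^+ 2) < 1 by rewrite sqrrN.
have Sp := q_binomial b q1 (normc_sqr_lt1 a1).
have Sm := q_binomial (- b) q1 (normc_sqr_lt1 an1).
rewrite (qbin_heine b q1 a1) in Sp; rewrite (qbin_heine (- b) q1 an1) !heineN in Sm.
have h : 1 - q != 0 by exact: onem_neq0.
have Ep : qpoch2 (- a) b q + qpoch2 a (- b) q
    = 2 * (qpoch a q * qpoch (- a) q) * F 0 0.
  by rewrite /qpoch2 -Sp -Sm; field.
have Em : qpoch2 (- a) b q - qpoch2 a (- b) q
    = 2 * (qpoch a q * qpoch (- a) q) * ((a - b) / (1 - q) * F 1 0).
  by rewrite /qpoch2 -Sp -Sm; field.
move: den; rewrite Ep Em mulf_eq0 negb_or => /andP[K0 F0]; split=> //.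
move: K0; rewrite !mulf_eq0 !negb_or => /andP[_ /andP[ka kb]].
by field; rewrite F0 h ka kb.
Qed.

Lemma cf_i_value : q != 0 -> normc (a * b / q) < 1 -> (forall n, c_i a b q n != 0) ->
  cf_has_value (c_i a b q) (d_i a b q) (Some ((qpoch2 (- a) b q - qpoch2 a (- b) q)
    / (qpoch2 (- a) b q + qpoch2 a (- b) q))).
Proof.
move=> q0 ab1 c0; have [F0 ->] := qpoch2_heine.
have qp0 n : 1 - q * (q ^+ 2) ^+ n != 0.
  by rewrite -exprM -exprS; apply: onem_neq0; exact: normcX_lt1.
pose e n := q * (1 - q * (q ^+ 2) ^+ n).
have pn := cvgc_X p1.
have eS : e ~> q.
  have := cvgcM (@cvgc_cst R q) (cvgcB (@cvgc_cst R 1) (cvgcM (@cvgc_cst R q) pn)).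
  by rewrite mulr0 subr0 mulr1.
have qplim (x y : R[i]) : (fun n => x - y * (q ^+ 2) ^+ n) ~> x.
  have h := cvgcB (@cvgc_cst R x) (cvgcM (@cvgc_cst R y) pn).
  by rewrite mulr0 subr0 in h; exact: h.
have abq1 : normc (a * b * q) < 1.
  have -> : a * b * q = a * b / q * q ^+ 2 by field.
  by rewrite normcM mulr_ilt1 ?normc_ge0.
(* This limit of [F n 0] is (abq; q^2) / (a^2; q^2) by the q-binomial theorem, nonzero because |abq|
   < 1. *)
have L0 : qbin (a ^+ 2) (a * b * q) (q ^+ 2) != 0.
  have := q_binomial (a * b * q) p1 a1; apply: contra_eq_neq => ->.
  by rewrite mul0r eq_sym qpoch_neq0.
have gL : (fun n => F n 0) ~> qbin (a ^+ 2) (a * b * q) (q ^+ 2).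
  apply: (heine_lim q1 p1 a1 (u := id) (v := fun=> 0%N)) => j.
  have pnj (x y : R[i]) : (fun n => x - y * (q ^+ 2) ^+ (n + j)) ~> x.
    have := qplim x y; rewrite -(cvgc_shiftn j) => h; exact: h.
  have pj : 1 - (q ^+ 2) ^+ j.+1 != 0 by apply: onem_neq0; exact: normcX_lt1.
  have h := cvgcM (cvgcM (cvgcM (@cvgc_cst R (a - b * q * (q ^+ 2) ^+ j)) (pnj a b))
    (@cvgc_cst R ((q ^+ 2) ^+ 0)))
   (cvgcV (mulf_neq0 (oner_neq0 R[i]) pj)
     (cvgcM (pnj 1 q) (@cvgc_cst R (1 - (q ^+ 2) ^+ j.+1)))).
  have -> : (a ^+ 2 - a * b * q * (q ^+ 2) ^+ j) / (1 - (q ^+ 2) ^+ j.+1)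
      = (a - b * q * (q ^+ 2) ^+ j) * a * (q ^+ 2) ^+ 0 / (1 * (1 - (q ^+ 2) ^+ j.+1)).
    by rewrite expr0 mulr1 mul1r; congr (_ / _); ring.
  exact: h.
have -> : (a - b) / (1 - q) * F 1 0 / F 0 0
    = c_i a b q 0 * F 1 0 / (e 0%N * F 0 0).
  rewrite /c_i /e /= expr0 mulr1; have h : 1 - q != 0 by exact: onem_neq0.
  by field; rewrite q0 h F0.
(* The limiting contraction factor is abq / q^2 = ab / q, of modulus below 1 by [ab1]. *)
apply: (@cf_value _ (c_i a b q) (d_i a b q) e (fun n => F n 0) _ (a * b / q) c0 _ _ gL L0
  _ ab1 F0).
- by move=> n; rewrite mulf_neq0.
- move=> n; rewrite /e heine_rec_m0 //.
  rewrite /d_i /c_i /= addn1 (exprS q (2 * n)) !(exprM q 2).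
  by have := qp0 n.+1 => h; field; rewrite q0 h.
have pS (x y : R[i]) : (fun n => x - y * (q ^+ 2) ^+ n.+1) ~> x.
  by rewrite (cvgc_shiftS (fun n => x - y * (q ^+ 2) ^+ n)); exact: qplim.
have eS1 := eS; rewrite -cvgc_shiftS in eS1.
have h := cvgcM (cvgcM (cvgcM (pS a b) (pS b a)) (@cvgc_cst R q))
  (cvgcV (mulf_neq0 q0 q0) (cvgcM eS eS1)).
have -> : a * b / q = a * b * q / (q * q) by field.
by apply: (cvgc_eq h) => n; rewrite /c_i /= (exprM q 2).
Qed.

Lemma cf_ii_value : (forall k, c_ii a b q k != 0) ->
  cf_has_value (c_ii a b q) (d_ii a b q) (Some ((qpoch2 (- a) b q - qpoch2 a (- b) q)
    / (qpoch2 (- a) b q + qpoch2 a (- b) q))).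
Proof.
move=> c0; have [F0 ->] := qpoch2_heine.
(* The two recurrences alternate along [F 0 0], [F 1 0], [F 1 1], [F 2 1], and so on. *)
pose e k := if odd k then 1 - a ^+ 2 * (q ^+ 2) ^+ k./2 else 1 - q * (q ^+ 2) ^+ k./2.
pose g k := F (uphalf k) k./2.
have ee n : e n.*2 = 1 - q * (q ^+ 2) ^+ n by rewrite /e odd_double doubleK.
have eo n : e n.*2.+1 = 1 - a ^+ 2 * (q ^+ 2) ^+ n.
  by rewrite /e /= odd_double /= uphalf_double.
have ge n : g n.*2 = F n n by rewrite /g uphalf_double doubleK.
have go n : g n.*2.+1 = F n.+1 n by rewrite /g /= doubleK uphalf_double.
have qp0 n : 1 - q * (q ^+ 2) ^+ n != 0.
  by rewrite -exprM -exprS; apply: onem_neq0; exact: normcX_lt1.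
have ap0 n : 1 - a ^+ 2 * (q ^+ 2) ^+ n != 0.
  apply: onem_neq0; rewrite normcM (le_lt_trans _ a1) // ler_piMr ?normc_ge0 //.
  exact: normcX_le1.
have e0 k : e k != 0 by rewrite /e; case: ifP.
have pn := cvgc_X p1.
have qplim (x y : R[i]) : (fun n => x - y * (q ^+ 2) ^+ n) ~> x.
  have h := cvgcB (@cvgc_cst R x) (cvgcM (@cvgc_cst R y) pn).
  by rewrite mulr0 subr0 in h; exact: h.
have qplimS (x y : R[i]) : (fun n => x - y * (q ^+ 2) ^+ n.+1) ~> x.
  by rewrite (cvgc_shiftS (fun n => x - y * (q ^+ 2) ^+ n)); exact: qplim.
have h11 : 1 * 1 != 0 :> R[i] by rewrite mulr1 oner_neq0.
(* The names refer to the parity of [k] in the numerator [c_ii a b q k.+1] entering the step at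
   [k]. *)
have ceven n : c_ii a b q n.*2.+1
    = (1 - a ^+ 2 * (q ^+ 2) ^+ n) * (1 - b ^+ 2 * (q ^+ 2) ^+ n) * (q * (q ^+ 2) ^+ n).
  by rewrite /c_ii /= odd_double /= subn1 /= (exprS q n.*2) -mul2n (exprM q 2).
have codd n : c_ii a b q n.*2.+2
    = (a - b * (q ^+ 2) ^+ n.+1) * (b - a * (q ^+ 2) ^+ n.+1) * (q * (q ^+ 2) ^+ n).
  rewrite /c_ii /= odd_double /= subn1 /= -doubleS (exprS q n.*2).
  by rewrite -!mul2n !(exprM q 2).
have glim : g ~> 1.
  (* The factor [(q ^+ 2) ^+ n] sends every term ratio to 0, leaving the initial term 1. *)
  have S (o : nat) : (fun n => F (n + o) n) ~> 1.
    rewrite -(hsum0 R).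
    apply: (heine_lim q1 p1 a1 (u := fun n => (n + o)%N) (v := id)) => j.
    have pj : 1 - (q ^+ 2) ^+ j.+1 != 0 by apply: onem_neq0; exact: normcX_lt1.
    have pnj (x y : R[i]) : (fun n => x - y * (q ^+ 2) ^+ (n + o + j)) ~> x.
      have h := qplim x y; rewrite -(cvgc_shiftn (o + j)) in h.
      by apply: (cvgc_eq h) => n; rewrite addnA.
    have h := cvgcM (cvgcM (cvgcM (@cvgc_cst R (a - b * q * (q ^+ 2) ^+ j)) (pnj a b))
      pn) (cvgcV (mulf_neq0 (oner_neq0 R[i]) pj)
       (cvgcM (pnj 1 q) (@cvgc_cst R (1 - (q ^+ 2) ^+ j.+1)))).
    by rewrite mulr0 mul0r in h; exact: h.
  apply: cvgc_even_odd.
    by apply: (cvgc_eq (S 0%N)) => n; rewrite addn0 ge.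
  by apply: (cvgc_eq (S 1%N)) => n; rewrite addn1 go.
(* The numerators carry a factor [q * (q ^+ 2) ^+ n] while [e] tends to 1, so the limiting
   contraction factor is 0. *)
have clim : (fun n => c_ii a b q n.+1 / (e n * e n.+1)) ~> 0.
  have qpn : (fun n => q * (q ^+ 2) ^+ n) ~> 0.
    by have h := cvgcM (@cvgc_cst R q) pn; rewrite mulr0 in h; exact: h.
  apply: cvgc_even_odd.
    have h := cvgcM (cvgcM (cvgcM (qplim 1 (a ^+ 2)) (qplim 1 (b ^+ 2))) qpn)
      (cvgcV h11 (cvgcM (qplim 1 q) (qplim 1 (a ^+ 2)))).
    rewrite mulr0 mul0r in h; apply: (cvgc_eq h) => n.
    by rewrite ceven ee eo.
  have h := cvgcM (cvgcM (cvgcM (qplimS a b) (qplimS b a)) qpn)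
    (cvgcV h11 (cvgcM (qplim 1 (a ^+ 2)) (qplimS 1 q))).
  rewrite mulr0 mul0r in h; apply: (cvgc_eq h) => n.
  by rewrite codd eo -doubleS ee.
have -> : (a - b) / (1 - q) * F 1 0 / F 0 0
    = c_ii a b q 0 * g 1%N / (e 0%N * g 0%N).
  rewrite /c_ii /e /g /= expr0 mulr1; have h : 1 - q != 0 by exact: onem_neq0.
  by field; rewrite h F0.
apply: (@cf_value _ (c_ii a b q) (d_ii a b q) e g 1 0 c0 e0 _ glim (oner_neq0 _)
  clim _ F0); last by rewrite normc0 ltr01.
have dd k : d_ii a b q k = 1 - a * b * (q ^+ 2) ^+ k by rewrite /d_ii exprM.
move=> k; rewrite -[k]odd_double_half.
case: (odd k); rewrite ?add1n ?add0n; move: k./2 => n.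
  rewrite codd dd eo go -doubleS ee ge go heine_rec_odd // addnn.
  by have := qp0 n.+1 => h; field.
rewrite ceven dd ee ge eo go -doubleS ge heine_rec_even // addnn.
by have := ap0 n => h; field.
Qed.

End Values.

Unset Implicit Arguments.
Set Strict Implicit.

Theorem corollary3p6 (R : realType) (a b q : R[i])
    (hq : `|q| < 1) (hq0 : q != 0)
    (hden : qpoch2 (- a) b q + qpoch2 a (- b) q != 0) :
  let r := (qpoch2 (- a) b q - qpoch2 a (- b) q)
           / (qpoch2 (- a) b q + qpoch2 a (- b) q) in
  (`|a ^+ 2| < 1 -> `|a * b / q| < 1 -> (forall n, c_i a b q n != 0) ->
     cf_has_value (c_i a b q) (d_i a b q) (Some r))
  /\
  (b != 0 -> `|a ^+ 2| < 1 -> `|a * q / b| < 1 ->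
     (forall k, c_ii a b q k != 0) ->
     cf_has_value (c_ii a b q) (d_ii a b q) (Some r)).
Proof.
have q1 : normc q < 1 by rewrite -normc_lt1.
move=> r; split=> [a1 ab1 c0|_ a1 _ c0].
  by apply: cf_i_value => //; rewrite -normc_lt1.
by apply: cf_ii_value => //; rewrite -normc_lt1.
Qed.
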